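(* For all $\alpha\in[0,2/9]$, it holds that \[\varphi_2(\alpha)\ge\frac{3}{4}\alpha\left(3-\sqrt{8\alpha+1}\right).\]
   Context: Let $d$ be a positive integer and $V$ a finite set. A $d$-system $E$ on $V$ is a family of $d$-element subsets of $V$. Its density is $\|E\|:=|E|/\binom{|V|}{d}$. The coboundary $\delta E$ of a $d$-system $E$ on $V$ is the $(d+1)$-system on $V$ consisting of those $(d+1)$-element subsets of $V$ that contain an odd number of sets of $E$. A $d$-system $E$ on $V$ is minimal if $\|E\|\le\|E'\|$ for every $d$-system $E'$ on $V$ with $\delta E=\delta E'$ (equivalently, $\|E\|\le\|E\,\triangle\,\delta D\|$ for every $(d-1)$-system $D$ on $V$, where $\triangle$ is the symmetric difference). Let $\mathcal{M}_d(V)$ be the set of all minimal $d$-systems on $V$. For $\alpha\in[0,1/2]$ define \[\varphi_d(\alpha):=\liminf_{|V|\to\infty}\min\{\|\delta E\| : E\in\mathcal{M}_d(V)\text{ and }\|E\|\ge\alpha\}.\] The claim concerns the case $d=2$. *)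

(* Defs.v *)
From mathcomp Require Import all_boot all_order all_algebra.
From mathcomp Require Import all_classical all_reals all_analysis.

Set Implicit Arguments.
Unset Strict Implicit.
Unset Printing Implicit Defensive.
Import Order.TTheory GRing.Theory Num.Theory.

Local Open Scope ring_scope.

Definition is_system (V : finType) (d : nat) (E : {set {set V}}) : bool :=
  [forall e in E, #|e| == d].

(* When #|V| < d the denominator is 0 and, since x / 0 = 0, the density is 0;
   this affects only finitely many cardinalities of V. *)
Definition density (R : realType) (V : finType) (d : nat) (E : {set {set V}}) : R :=
  #|E|%:R / 'C(#|V|, d)%:R.

Definition coboundary (V : finType) (d : nat) (E : {set {set V}}) : {set {set V}} :=
  [set f : {set V} | (#|f| == d.+1) && odd #|[set e in E | e \subset f]|]%SET.

Definition minimal_systems (R : realType) (V : finType) (d : nat) :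
    {set {set {set V}}} :=
  [set E : {set {set V}} | is_system d E &&
     [forall E' : {set {set V}},
        is_system d E' ==> (coboundary d E == coboundary d E') ==>
        (density R d E <= density R d E')]]%SET.

(* The value is +oo when no minimal d-system on V has density at least alpha
   (minimum over the empty set). *)
Definition min_coboundary_density (R : realType) (V : finType) (d : nat)
    (alpha : R) : \bar R :=
  \big[Order.min/+oo%E]_(E in minimal_systems R V d | alpha <= density R d E)
     (density R d.+1 (coboundary d E))%:E.

(* min_coboundary_density only depends on the cardinality of V, so 'I_n stands
   for all the sets V of cardinality n. *)
Definition phi (R : realType) (d : nat) (alpha : R) : \bar R :=
  limn_einf (fun n => min_coboundary_density 'I_n d alpha).

(* Main.v *)
Require Import Defs.
From mathcomp Require Import all_boot all_order all_algebra.
From mathcomp Require Import all_classical all_reals all_analysis.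
From mathcomp Require Import ring lra finset.
Import Order.TTheory GRing.Theory Num.Theory numFieldNormedType.Exports.
Local Open Scope ring_scope.

(** For a graph E on n vertices with degrees d(v), let L(v) be the sum of the
    degrees over the neighbours of v, t(v) twice the number of triangles
    through v, and put a = 2|E|/n^2. Counting odd triples gives
    6 |coboundary E| = 3 n sum d - 6 sum d^2 + 4 sum t, and sum L = sum d^2.
    Minimality says that no cut contains more than half of its pairs; the cuts
    at v and at its neighbourhood yield 2 d <= n and 2 L <= d (n - d) + 2 t.
    Counting the edges that meet the neighbourhood of v gives
    2 L <= a n^2 + t. Using the former bound on L at vertices of low degree and
    the latter at vertices of high degree, one gets for a weight k in [1/2, 2/3]
      (1 - k) d^2 + k L <= ((1 - k)/2 + k a) n d + k t
    as soon as (1 - k)(2k - 1) <= k^2 a. Summing over v, the coboundary has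
    density at least 3 k a (1 - 2a). For alpha = u(1 + u)/2 the choice
    k = (1 - u) / (2 (1 - u - u^2)) turns this at a = alpha into the claimed
    value, and the condition on k at a = alpha into (1 - 3u)^2 >= 0. When
    a > 1/4, the bound 3 |coboundary E| >= n |E| already suffices. *)

(** * Sums over pairs and triples as sums over ordered tuples *)

(** Double counting of the pairs of a set [f] of size [k.+1] and a point [x] of it: on the right,
    [e] is [f] without [x]. *)
Lemma sum_card_succ (R : pzSemiRingType) (V : finType) (k : nat)
    (F : {set V} -> R) :
  k.+1%:R * (\sum_(f : {set V} | #|f| == k.+1) F f) =
  \sum_(e : {set V} | #|e| == k) \sum_(x | x \notin e) F (x |: e)%SET.
Proof.
rewrite [RHS](exchange_big_dep predT)//=.
rewrite (eq_bigr (fun x : V => \sum_(f : {set V} | (#|f| == k.+1) && (x \in f)) F f)).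
  rewrite (exchange_big_dep (fun f : {set V} => #|f| == k.+1))//=; last first.
    by move=> x f _ /andP[].
  rewrite mulr_sumr; apply: eq_bigr => f /eqP fk.
  under eq_bigl do rewrite fk eqxx/=.
  by rewrite sumr_const fk mulr_natl.
move=> x _; rewrite [RHS](reindex_onto (fun e => x |: e)%SET (fun f => f :\ x)%SET)/=.
  apply: eq_bigl => e; rewrite setU11 andbT cardsU1.
  case: (boolP (x \in e)) => [xe|xe]; last by rewrite setU1K// eqxx andbT add1n.
  rewrite andbF; apply/esym/negbTE; rewrite negb_and; apply/orP; right.
  by apply: contraL xe => /eqP <-; rewrite !inE eqxx.
by move=> f /andP[_ xf]; rewrite setD1K.
Qed.

Lemma sum_card1 (R : pzSemiRingType) (V : finType) (F : {set V} -> R) :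
  \sum_(e : {set V} | #|e| == 1) F e = \sum_x F [set x]%SET.
Proof.
have := @sum_card_succ R V 0 F; rewrite mul1r => ->.
rewrite (big_pred1 set0) => [|e]; last by rewrite cards_eq0.
by apply: eq_big => x; rewrite ?inE// setU0.
Qed.

Lemma sum_card2 (R : pzSemiRingType) (V : finType) (F : {set V} -> R) :
  2 * (\sum_(e : {set V} | #|e| == 2) F e) =
  \sum_x \sum_(y | y != x) F [set y; x]%SET.
Proof.
rewrite sum_card_succ sum_card1; apply: eq_bigr => x _.
by apply: eq_bigl => y; rewrite inE.
Qed.

Lemma sum_card3 (R : pzSemiRingType) (V : finType) (F : {set V} -> R) :
  6 * (\sum_(f : {set V} | #|f| == 3) F f) =
  \sum_x \sum_(y | y != x) \sum_(z | (z != y) && (z != x)) F (z |: [set y; x])%SET.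
Proof.
have -> : 6 = 2 * 3 :> R by rewrite -natrM.
rewrite -mulrA sum_card_succ sum_card2.
apply: eq_bigr => x _; apply: eq_bigr => y _.
by apply: eq_bigl => z; rewrite !inE negb_or.
Qed.

(** * Odd triples in terms of adjacency *)

Lemma card_facets {V : finType} {d : nat} {E : {set {set V}}} {f : {set V}} :
  is_system d E -> #|f| = d.+1 ->
  #|[set e in E | e \subset f]| = (\sum_(x in f) ((f :\ x)%SET \in E))%N.
Proof.
move=> /forall_inP Ed fd.
have -> : [set e in E | e \subset f] =
    [set f :\ x | x in [set x in f | f :\ x \in E]]%SET.
  apply/setP => e; rewrite !inE; apply/andP/imsetP => [[eE ef]|[x]].
    have /cards1P[x fex] : #|f :\: e| == 1%N.
      by rewrite cardsD (setIidPr ef) fd (eqP (Ed _ eE)) subSnn.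
    have fxe : (f :\ x)%SET = e by rewrite -fex setDDr setDv set0U (setIidPr ef).
    exists x => //; rewrite !inE fxe eE andbT.
    by have : x \in (f :\: e) by [rewrite fex inE]; rewrite inE => /andP[].
  by rewrite inE => /andP[_ fxE] ->; rewrite subD1set.
rewrite card_in_imset.
  rewrite -sum1_card (eq_bigl (fun x => (x \in f) && ((f :\ x)%SET \in E))).
    by rewrite big_mkcondr; apply: eq_bigr => x _; case: ifP.
  by move=> x; rewrite inE.
move=> x y; rewrite !inE => /andP[xf _] /andP[yf _] fxy.
by move/setP/(_ y): fxy; rewrite !inE eqxx yf andbT => /negbFE/eqP.
Qed.

Lemma mem_coboundary2 {V : finType} {E : {set {set V}}} {x y z : V} :
  is_system 2 E -> y != x -> z != y -> z != x ->
  (z |: [set y; x] \in coboundary 2 E) =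
  ([set x; y] \in E) (+) ([set y; z] \in E) (+) ([set z; x] \in E) :> bool.
Proof.
move=> E2 yx zy zx.
have f3 : #|(z |: [set y; x])%SET| = 3%N.
  by rewrite cardsU1 cards2 yx !inE (negbTE zy) (negbTE zx).
rewrite inE f3 eqxx (card_facets E2 f3) big_setU1 ?big_setU1 ?big_set1 ?inE//=;
  last by rewrite (negbTE zy) (negbTE zx).
have -> : ((z |: [set y; x]) :\ z = [set x; y])%SET.
  by rewrite setU1K 1?setUC// !inE negb_or zy zx.
have -> : ((z |: [set y; x]) :\ y = [set z; x])%SET.
  by rewrite setUCA setU1K// !inE negb_or eq_sym zy.
have -> : ((z |: [set y; x]) :\ x = [set y; z])%SET.
  rewrite setUA setUC setU1K; first by rewrite setUC.
  by rewrite !inE negb_or ![x == _]eq_sym zx.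
by rewrite !oddD !oddb -!addbA [X in _ (+) X]addbC.
Qed.
Definition adj (R : pzSemiRingType) (V : finType) (E : {set {set V}}) (x y : V) : R :=
  ([set x; y]%SET \in E)%:R.
Arguments adj R {V} E x y.

Lemma adjC (R : pzSemiRingType) (V : finType) (E : {set {set V}}) (x y : V) :
  adj R E x y = adj R E y x.
Proof. by rewrite /adj setUC. Qed.

Lemma adjxx (R : pzSemiRingType) (V : finType) (E : {set {set V}}) (x : V) :
  is_system 2 E -> adj R E x x = 0.
Proof.
move=> /forall_inP E2; rewrite /adj; case: (boolP (_ \in E)) => // /E2.
by rewrite setUid cards1.
Qed.

Lemma sum_adj (R : pzSemiRingType) (V : finType) (E : {set {set V}}) :
  is_system 2 E -> \sum_x \sum_y adj R E x y = 2 * #|E|%:R.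
Proof.
move=> E2; have -> : #|E|%:R = \sum_(e : {set V} | #|e| == 2) (e \in E)%:R :> R.
  rewrite -sum1_card natr_sum big_mkcond [RHS]big_mkcond; apply: eq_bigr => e _.
  by case: ifP => [/(forall_inP E2)->//|_]; case: ifP.
rewrite sum_card2; apply: eq_bigr => x _.
rewrite (bigD1 x)//= adjxx// add0r; apply: eq_bigr => y _.
by rewrite adjC.
Qed.

(** The summand is the polynomial giving the parity of three 0/1 values. It vanishes when two of the
    vertices coincide, because then one value is 0 and the other two are equal; so the sum may run
    over all ordered triples. *)
Lemma coboundary_sum (R : comPzRingType) (V : finType) (E : {set {set V}}) :
  is_system 2 E ->
  6 * #|coboundary 2 E|%:R = \sum_x \sum_y \sum_z
    (adj R E x y + adj R E y z + adj R E z x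
     - 2 * (adj R E x y * adj R E y z + adj R E y z * adj R E z x
            + adj R E z x * adj R E x y)
     + 4 * (adj R E x y * adj R E y z * adj R E z x)).
Proof.
move=> E2.
have -> : #|coboundary 2 E|%:R =
    \sum_(f : {set V} | #|f| == 3) (f \in coboundary 2 E)%:R :> R.
  rewrite -sum1_card natr_sum big_mkcond [RHS]big_mkcond; apply: eq_bigr => f _.
  case: (boolP (f \in _)) => [|_]; last by case: ifP.
  by rewrite inE => /andP[-> _].
have sq x y : adj R E x y * adj R E x y = adj R E x y.
  by rewrite /adj; case: (_ \in E); rewrite ?mulr1 ?mulr0.
rewrite sum_card3; apply: eq_bigr => x _.
rewrite [RHS](bigD1 x)//= [X in _ = X + _]big1 ?add0r => [|z _]; last first.
  by rewrite adjxx// [adj R E z x]adjC; ring: (sq x z).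
apply: eq_bigr => y yx.
rewrite [RHS](bigD1 y)//= [X in _ = _ + X](bigD1 x)/= 1?eq_sym//.
rewrite !adjxx// [adj R E y x]adjC.
rewrite [X in _ = X + _](_ : _ = 0) ?add0r; last by ring: (sq x y).
rewrite [X in _ = X + _](_ : _ = 0) ?add0r; last by ring: (sq x y).
apply: eq_bigr => z /andP[zy zx].
rewrite (mem_coboundary2 E2 yx zy zx) /adj.
by do 3!case: (_ \in E) => /=; ring.
Qed.

(** * Switching at a vertex set *)

(** Switching the pairs between [S] and its complement preserves the coboundary. The double sum is
    the resulting change in the number of edges, which minimality makes nonnegative. *)
Lemma minimal_cut {R : realType} {V : finType} {E : {set {set V}}} (S : {set V}) :
  (1 < #|V|)%N -> E \in minimal_systems R V 2 ->
  0 <= \sum_x \sum_y (x \in S)%:R * (1 - (y \in S)%:R) * (1 - 2 * adj R E x y).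
Proof.
move=> V1; rewrite inE => /andP[E2 /forallP Emin].
pose s x := (x \in S).
(* E switched at S: it differs from E exactly on the pairs cut by S. *)
pose E' : {set {set V}} := [set e : {set V} | (#|e| == 2) &&
  ((e \in E) (+) odd #|e :&: S|)]%SET.
have E'2 : is_system 2 E' by apply/forall_inP => e; rewrite inE => /andP[].
have E'P x y : x != y ->
    ([set x; y] \in E')%SET = ([set x; y] \in E)%SET (+) s x (+) s y.
  move=> xy; rewrite inE cards2 xy eqxx/= -addbA; congr (_ (+) _).
  rewrite -sum1_card (eq_bigl (fun z => (z \in [set x; y])%SET && (z \in S))); last first.
    by move=> z; rewrite inE.
  rewrite big_mkcondr big_setU1 ?big_set1 ?inE//= oddD /s.
  by case: (x \in S); case: (y \in S).
have cobE : coboundary 2 E == coboundary 2 E'.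
  apply/eqP/setP => f; case: (boolP (#|f| == 3)) => [f3|/negbTE f3]; last first.
    by rewrite !inE f3.
  have /card_gt0P[x xf] : (0 < #|f|)%N by rewrite (eqP f3).
  have /card_gt0P[y] : (0 < #|f :\ x|)%N.
    by have := cardsD1 x f; rewrite xf (eqP f3); case: #|_ :\ _|.
  rewrite finset.in_setD1 => /andP[yx yf].
  have /card_gt0P[z] : (0 < #|f :\ x :\ y|)%N.
    have := cardsD1 x f; rewrite xf (eqP f3) (cardsD1 y (f :\ x)) !inE yx yf.
    by case: #|_ :\ _|.
  rewrite !finset.in_setD1 => /and3P[zy zx zf].
  have -> : f = (z |: [set y; x])%SET.
    apply/esym/eqP; rewrite eqEcard (eqP f3) cardsU1 cards2 yx !inE (negbTE zy) (negbTE zx) andbT.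
    by apply/fintype.subsetP => t; rewrite !inE => /or3P[] /eqP ->.
  (* Each vertex of the triple lies in two of its three pairs, so [s x], [s y] and [s z] all
     cancel. *)
  rewrite !mem_coboundary2// !E'P// 1?eq_sym//.
  by do 3!case: (_ \in E); case: (s x); case: (s y); case: (s z).
have := Emin E'; rewrite E'2 cobE/= /density ler_pM2r; last first.
  by rewrite invr_gt0 ltr0n bin_gt0.
move=> EE'.
have : 2 * #|E|%:R <= 2 * #|E'|%:R :> R by rewrite ler_pM2l.
rewrite -!sum_adj// -subr_ge0 -sumrB.
pose t x y : R := (x \in S)%:R * (1 - (y \in S)%:R) * (1 - 2 * adj R E x y).
rewrite (_ : \sum_i (_ - _) = \sum_x \sum_y (t x y + t y x)).
  rewrite (eq_bigr (fun x => \sum_y t x y + \sum_y t y x)) => [|x _]; last exact: big_split.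
  rewrite big_split/= [X in _ + X]exchange_big/=.
  by rewrite -mulr2n pmulrn_lge0.
apply: eq_bigr => x _; rewrite -sumrB; apply: eq_bigr => y _.
rewrite /t [adj R E y x]adjC; have [<-|xy] := eqVneq x y.
  by rewrite !adjxx//; case: (x \in S) => /=; ring.
rewrite /adj E'P// /s.
by case: (_ \in E); case: (x \in S); case: (y \in S) => /=; ring.
Qed.

(** * Degrees, triangles and the local inequalities *)

Definition deg (R : pzSemiRingType) (V : finType) (E : {set {set V}}) (x : V) : R :=
  \sum_y adj R E x y.
Arguments deg R {V} E x.

Definition nbr_deg (R : pzSemiRingType) (V : finType) (E : {set {set V}}) (x : V) : R :=
  \sum_y adj R E x y * deg R E y.
Arguments nbr_deg R {V} E x.

(* Every triangle through x is counted twice. *)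
Definition tri (R : pzSemiRingType) (V : finType) (E : {set {set V}}) (x : V) : R :=
  \sum_y \sum_z adj R E x y * adj R E x z * adj R E y z.
Arguments tri R {V} E x.

Lemma adj_ge0 (R : numDomainType) (V : finType) (E : {set {set V}}) (x y : V) :
  0 <= adj R E x y.
Proof. exact: ler0n. Qed.

Lemma adj_le1 (R : numDomainType) (V : finType) (E : {set {set V}}) (x y : V) :
  adj R E x y <= 1.
Proof. by rewrite lern1 leq_b1. Qed.

Lemma deg_ge0 (R : numDomainType) (V : finType) (E : {set {set V}}) (x : V) :
  0 <= deg R E x.
Proof. by apply: sumr_ge0 => y _; exact: adj_ge0. Qed.

Lemma tri_ge0 (R : numDomainType) (V : finType) (E : {set {set V}}) (x : V) :
  0 <= tri R E x.
Proof. by do 2!apply: sumr_ge0 => ? _; rewrite !mulr_ge0 ?adj_ge0. Qed.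

Lemma sum_nbr_deg (R : comPzSemiRingType) (V : finType) (E : {set {set V}}) :
  \sum_x nbr_deg R E x = \sum_x deg R E x ^+ 2.
Proof.
rewrite exchange_big/=; apply: eq_bigr => y _.
by rewrite -mulr_suml expr2; congr (_ * _); apply: eq_bigr => x _; exact: adjC.
Qed.

Lemma coboundary_deg (R : comPzRingType) (V : finType) (E : {set {set V}}) :
  is_system 2 E ->
  6 * #|coboundary 2 E|%:R = 3 * #|V|%:R * (\sum_x deg R E x)
    - 6 * (\sum_x deg R E x ^+ 2) + 4 * (\sum_x tri R E x).
Proof.
move=> E2; rewrite coboundary_sum//.
(* [c x y] counts the common neighbours of [x] and [y]; summing it over all [y], or over the
   neighbours [y] of [x], yields [nbr_deg] and [tri]. *)
pose c x y : R := \sum_z adj R E y z * adj R E z x.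
have degr x : \sum_y adj R E y x = deg R E x by apply: eq_bigr => y _; exact: adjC.
have sumV (a : R) : \sum_(y : V) a = #|V|%:R * a by rewrite sumr_const mulr_natl.
have sumc x : \sum_y c x y = nbr_deg R E x.
  rewrite exchange_big/=; apply: eq_bigr => z _.
  by rewrite -mulr_suml degr mulrC [adj R E z x]adjC.
have sumac x : \sum_y adj R E x y * c x y = tri R E x.
  apply: eq_bigr => y _; rewrite mulr_sumr; apply: eq_bigr => z _.
  by rewrite [adj R E z x]adjC [adj R E y z * _]mulrC mulrA.
transitivity (\sum_x \sum_y (#|V|%:R * adj R E x y + deg R E y + deg R E x
    - 2 * (adj R E x y * deg R E y + c x y + deg R E x * adj R E x y)
    + 4 * (adj R E x y * c x y))).
  apply: eq_bigr => x _; apply: eq_bigr => y _.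
  rewrite !(big_split, sumrN)/= -!mulr_sumr !big_split/=.
  rewrite -!mulr_sumr -!mulr_suml degr sumV -/(c x y) -/(deg R E y).
  congr (_ + 4 * _); rewrite mulr_sumr; apply: eq_bigr => z _.
  by rewrite mulrA.
transitivity (\sum_x (#|V|%:R * deg R E x + \sum_y deg R E y + #|V|%:R * deg R E x
    - 2 * (nbr_deg R E x + nbr_deg R E x + deg R E x ^+ 2) + 4 * tri R E x)).
  apply: eq_bigr => x _.
  rewrite !(big_split, sumrN)/= -!mulr_sumr !big_split/=.
  by rewrite -!mulr_sumr sumV sumc sumac -expr2.
rewrite !(big_split, sumrN)/= -!mulr_sumr !big_split/= sumV sum_nbr_deg.
by ring.
Qed.

(** Inclusion-exclusion: the difference of the two sides counts the ordered edges with no end in the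
    neighbourhood of [v]. *)
Lemma nbr_deg_le_sum (R : realDomainType) (V : finType) (E : {set {set V}}) (v : V) :
  2 * nbr_deg R E v <= \sum_x deg R E x + tri R E v.
Proof.
have nbrE : nbr_deg R E v = \sum_x \sum_y adj R E v y * adj R E x y.
  rewrite exchange_big/=; apply: eq_bigr => x _; rewrite mulr_sumr.
  by apply: eq_bigr => y _; rewrite [adj R E y x]adjC.
have nbrE' : nbr_deg R E v = \sum_x \sum_y adj R E v x * adj R E x y.
  by apply: eq_bigr => x _; rewrite mulr_sumr.
have : 0 <= \sum_x \sum_y adj R E x y * ((1 - adj R E v x) * (1 - adj R E v y)).
  do 2!apply: sumr_ge0 => ? _.
  by rewrite !mulr_ge0 ?adj_ge0 ?subr_ge0 ?adj_le1.
rewrite (eq_bigr (fun x => deg R E x - \sum_y adj R E v x * adj R E x y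
    - \sum_y adj R E v y * adj R E x y
    + \sum_y adj R E v x * adj R E v y * adj R E x y)) => [|x _]; last first.
  by rewrite -!sumrB -big_split; apply: eq_bigr => y _ /=; ring.
rewrite big_split/= !sumrB -nbrE -nbrE' -/(tri R E v); lra.
Qed.

Lemma minimal_deg (R : realType) (V : finType) (E : {set {set V}}) (v : V) :
  (1 < #|V|)%N -> E \in minimal_systems R V 2 -> 2 * deg R E v <= #|V|%:R.
Proof.
move=> V1 Emin; have := minimal_cut [set v]%SET V1 Emin.
have E2 : is_system 2 E by move: Emin; rewrite inE => /andP[].
rewrite (bigD1 v)//= [X in _ + X]big1 ?addr0 => [|x xv]; last first.
  by rewrite big1// => y _; rewrite !inE (negbTE xv) !mul0r.
rewrite (bigD1 v)//= !inE eqxx subrr mulr0 mul0r add0r.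
rewrite (eq_bigr (fun y => 1 - 2 * adj R E v y)) => [|y yv]; last first.
  by rewrite !inE (negbTE yv) subr0 !mul1r.
have -> : deg R E v = \sum_(y | y != v) adj R E v y.
  by rewrite /deg (bigD1 v)//= adjxx// add0r.
rewrite sumrB -mulr_sumr.
(* The cut at [v] has only n - 1 pairs; n is a convenient upper bound. *)
have : \sum_(i | i != v) 1 <= \sum_(i : V) 1 :> R.
  by rewrite [leRHS](bigD1 v)//= lerDr ler01.
rewrite [X in _ <= X]sumr_const; lra.
Qed.

(** The cut at the neighbourhood of [v] has d (n - d) pairs, and L - t of them are edges, since t
    counts the ordered edges inside the neighbourhood. *)
Lemma minimal_nbr_deg (R : realType) (V : finType) (E : {set {set V}}) (v : V) :
  (1 < #|V|)%N -> E \in minimal_systems R V 2 ->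
  2 * nbr_deg R E v <= deg R E v * (#|V|%:R - deg R E v) + 2 * tri R E v.
Proof.
move=> V1 Emin; have := minimal_cut [set x | [set v; x]%SET \in E]%SET V1 Emin.
rewrite (eq_bigr (fun x => adj R E v x * (#|V|%:R - deg R E v)
   - 2 * (adj R E v x * deg R E x)
   + 2 * \sum_y adj R E v x * adj R E v y * adj R E x y)) => [|x _]; last first.
  transitivity (\sum_y (adj R E v x * (1 - adj R E v y)
     - 2 * (adj R E v x * adj R E x y) + 2 * (adj R E v x * adj R E v y * adj R E x y))).
    by apply: eq_bigr => y _; rewrite !inE -!/(adj R E v _); ring.
  rewrite big_split/= sumrB/= -!mulr_sumr; congr (_ * _ - _ + _).
  by rewrite sumrB sumr_const.
rewrite big_split/= sumrB/= -!mulr_sumr -!mulr_suml -/(deg R E v) -/(nbr_deg R E v).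
rewrite -/(tri R E v); lra.
Qed.

(** * Lower bounds for the coboundary *)

(** The inequality at one vertex, normalised: [x], [l], [t] stand for d/n, L/n^2, t/n^2. *)
Lemma weighted_degree_bound {R : realFieldType} {k a x l t : R} :
  1 / 2 <= k <= 2 / 3 -> (1 - k) * (2 * k - 1) <= k ^+ 2 * a ->
  0 <= x <= 1 / 2 -> 0 <= t -> 2 * l <= x * (1 - x) + 2 * t -> 2 * l <= a + t ->
  (1 - k) * x ^+ 2 + k * l <= ((1 - k) / 2 + k * a) * x + k * t.
Proof.
move=> /andP[k1 k2] hka /andP[x0 x1] t0 h1 h2.
have k0 : 0 <= k by lra.
have [xs|xl] := lerP (x * (1 - k)) (k * a).
  have : k * (2 * l) <= k * (x * (1 - x) + 2 * t) by rewrite ler_wpM2l.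
  suff : 0 <= x * (1 / 2 - k + k * a - (1 - 3 / 2 * k) * x) by lra.
  rewrite mulr_ge0// -(@pmulr_rge0 _ (1 - k)); last by lra.
  (* The second factor does not increase with [x], as k <= 2/3. At the threshold x (1 - k) = k a its
     product with 1 - k is half the slack of [hka]. *)
  have : (1 - 3 / 2 * k) * (x * (1 - k)) <= (1 - 3 / 2 * k) * (k * a).
    by rewrite ler_wpM2l//; lra.
  lra.
have : k * (2 * l) <= k * (a + t) by rewrite ler_wpM2l.
have : 0 <= (1 / 2 - x) * (x * (1 - k) - k * a) by rewrite mulr_ge0//; lra.
have : 0 <= k * t by rewrite mulr_ge0.
lra.
Qed.

Lemma coboundary_ge_weighted (R : realType) (V : finType) (E : {set {set V}})
    (k : R) :
  let n : R := #|V|%:R in let a := 2 * #|E|%:R / n ^+ 2 in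
  (1 < #|V|)%N -> E \in minimal_systems R V 2 ->
  1 / 2 <= k <= 2 / 3 -> (1 - k) * (2 * k - 1) <= k ^+ 2 * a ->
  3 * k * a * (1 - 2 * a) <= 6 * #|coboundary 2 E|%:R / n ^+ 3.
Proof.
move=> n a V1 Emin hk hka; have E2 : is_system 2 E by move: Emin; rewrite inE => /andP[].
have n0 : 0 < n by rewrite ltr0n ltnW.
have nn0 : n != 0 by rewrite gt_eqF.
have nE (z w : R) i : (z <= w * n ^+ i) = (z / n ^+ i <= w).
  by rewrite ler_pdivrMr// exprn_gt0.
have sumdeg : \sum_x deg R E x = a * n ^+ 2 by rewrite sum_adj// mulfVK// expf_neq0.
have pt v : (1 - k) * (deg R E v / n) ^+ 2 + k * (nbr_deg R E v / n ^+ 2) <=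
    ((1 - k) / 2 + k * a) * (deg R E v / n) + k * (tri R E v / n ^+ 2).
  apply: weighted_degree_bound => //.
  - rewrite divr_ge0 ?deg_ge0 ?(ltW n0)//= ler_pdivrMr//.
    by have := minimal_deg R V E v V1 Emin; rewrite -/n; lra.
  - by rewrite divr_ge0 ?tri_ge0 ?exprn_ge0 ?(ltW n0).
  - rewrite mulrA -nE; have := minimal_nbr_deg R V E v V1 Emin; rewrite -/n.
    by congr (_ <= _); field.
  - rewrite mulrA -nE [X in _ <= X]mulrDl -sumdeg divfK ?expf_neq0//.
    exact: nbr_deg_le_sum.
have : \sum_v ((1 - k) * (deg R E v / n) ^+ 2 + k * (nbr_deg R E v / n ^+ 2)) <=
    \sum_v (((1 - k) / 2 + k * a) * (deg R E v / n) + k * (tri R E v / n ^+ 2)).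
  by apply: ler_sum => v _; exact: pt.
under eq_bigr do rewrite expr_div_n.
rewrite !big_split/= -!mulr_sumr -!mulr_suml sum_nbr_deg sumdeg -/n.
rewrite coboundary_deg// -/n sumdeg.
(* As L also sums to [D], the weights 1 - k and k add up to 1. *)
set D := \sum_x _ ^+ 2; set T := \sum_x _; rewrite -mulrDl subrK mul1r => DT.
have T0 : 0 <= T / n ^+ 3.
  by rewrite divr_ge0 ?exprn_ge0 ?(ltW n0)//; apply: sumr_ge0 => v _; exact: tri_ge0.
have {}DT : D / n ^+ 3 <= ((1 - k) / 2 + k * a) * a + k * (T / n ^+ 3).
  move: DT; rewrite -(@ler_pM2r _ n^-1) ?invr_gt0//.
  by congr (_ <= _); field.
rewrite (_ : _ / n ^+ 3 = 3 * a - 6 * (D / n ^+ 3) + 4 * (T / n ^+ 3)); last by field.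
move: hk => /andP[_ k2].
(* Eliminating [D] leaves the triangles with coefficient 4 - 6k. *)
have : 0 <= (2 / 3 - k) * (T / n ^+ 3) by rewrite mulr_ge0// subr_ge0.
lra.
Qed.

(* Gromov's bound: switching at the neighbourhood of v replaces E by the link of
   v in the coboundary. *)
Lemma coboundary_ge_density (R : realType) (V : finType) (E : {set {set V}}) :
  (1 < #|V|)%N -> E \in minimal_systems R V 2 ->
  #|V|%:R * #|E|%:R <= 3 * #|coboundary 2 E|%:R :> R.
Proof.
move=> V1 Emin; have E2 : is_system 2 E by move: Emin; rewrite inE => /andP[].
have := coboundary_deg R V E E2; have := sum_adj R V E E2.
have : \sum_v 2 * nbr_deg R E v <=
    \sum_v (deg R E v * (#|V|%:R - deg R E v) + 2 * tri R E v).
  by apply: ler_sum => v _; exact: minimal_nbr_deg.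
under [X in _ <= X]eq_bigr do rewrite mulrBr -expr2.
rewrite big_split sumrB/= -!mulr_sumr -mulr_suml sum_nbr_deg => + degE.
rewrite -/(deg R E) degE; lra.
Qed.

Lemma coboundary_ge_sqrt (R : realType) (V : finType) (E : {set {set V}})
    (b : R) :
  (1 < #|V|)%N -> E \in minimal_systems R V 2 -> 0 <= b <= 2 / 9 ->
  b <= 2 * #|E|%:R / #|V|%:R ^+ 2 ->
  3 / 4 * b * (3 - Num.sqrt (8 * b + 1)) <= 6 * #|coboundary 2 E|%:R / #|V|%:R ^+ 3.
Proof.
move=> V1 Emin /andP[b0 b1] hb.
set s := Num.sqrt _.
have s2 : s ^+ 2 = 8 * b + 1 by rewrite sqr_sqrtr//; lra.
have s0 : 0 <= s by exact: sqrtr_ge0.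
have [u [u0 u1 sE bE]] : exists u, [/\ 0 <= u, u <= 1 / 3, s = 2 * u + 1 & b = u * (u + 1) / 2].
  exists ((s - 1) / 2); split; [| |by field|].
  - by have : 1 <= s by [rewrite -sqrtr1 ler_wsqrtr//; lra]; lra.
  - suff : s <= 5 / 3 by lra.
    by rewrite -(@ler_pXn2r _ 2)// ?nnegrE//; lra.
  - have -> : b = (s ^+ 2 - 1) / 8 by rewrite s2; field.
    by field.
have n0 : 0 < #|V|%:R :> R by rewrite ltr0n ltnW.
set a : R := 2 * _ / _ in hb *.
(* The function a (1 - 2a) increases only up to 1/4. Beyond that, the coboundary term is at least
   [a], while the claimed bound is at most 1/4. *)
have [a4|a4] := lerP a (1 / 4); last first.
  have : a <= 6 * #|coboundary 2 E|%:R / #|V|%:R ^+ 3.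
    rewrite ler_pdivlMr ?exprn_gt0//.
    have := coboundary_ge_density R V E V1 Emin.
    rewrite (_ : a * _ = 2 * (#|V|%:R * #|E|%:R)); first by lra.
    by rewrite /a; field; rewrite gt_eqF.
  apply: le_trans; apply: le_trans (ltW a4).
  have : 0 <= b * (s - 1) by rewrite mulr_ge0// sE; lra.
  have : b * u <= 1 / 9 by nra.
  rewrite sE; nra.
have N0 : 0 < 1 - u - u ^+ 2 by nra.
(* Solves 3 k b (1 - 2b) = 3 b (1 - u) / 2, the claimed value, where 1 - 2b = 1 - u - u^2. *)
pose k := (1 - u) / (2 * (1 - u - u ^+ 2)).
have kN : k * (2 * (1 - u - u ^+ 2)) = 1 - u.
  by rewrite mulfVK// mulf_neq0// gt_eqF.
have k1 : 1 / 2 <= k by rewrite ler_pdivlMr; nra.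
have k2 : k <= 2 / 3 by rewrite ler_pdivrMr; nra.
have hka : (1 - k) * (2 * k - 1) <= k ^+ 2 * a.
  apply: (@le_trans _ _ (k ^+ 2 * b)); last by rewrite ler_wpM2l// sqr_ge0.
  rewrite -subr_ge0 (_ : _ - _ =
    u * (1 + u) * (1 - 3 * u) ^+ 2 / (8 * (1 - u - u ^+ 2) ^+ 2)).
    by rewrite divr_ge0 ?mulr_ge0 ?sqr_ge0//; lra.
  by rewrite bE /k; field; rewrite gt_eqF.
apply: le_trans (coboundary_ge_weighted R V E k V1 Emin _ hka); last by rewrite k1.
rewrite -/a; apply: (@le_trans _ _ (3 * k * b * (1 - 2 * b))).
  rewrite bE sE (_ : 3 * k * _ * _ = 3 * (u * (u + 1) / 2) * (k * (2 * (1 - u - u ^+ 2))) / 2);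
    last by field.
  by rewrite kN; lra.
have : 0 <= k * ((a - b) * (1 - 2 * (a + b))).
  by apply: mulr_ge0; [lra|apply: mulr_ge0; lra].
lra.
Qed.

(** * Passage to densities and to the limit *)

Lemma density2E (R : realType) (V : finType) (E : {set {set V}}) :
  (1 < #|V|)%N ->
  (1 - #|V|%:R^-1) * density R 2 E = 2 * #|E|%:R / #|V|%:R ^+ 2.
Proof.
move=> V1; have n0 : #|V|%:R != 0 :> R by rewrite pnatr_eq0 -lt0n ltnW.
have nB : (#|V|.-1)%:R = #|V|%:R - 1 :> R by rewrite -subn1 natrB// ltnW.
have n1 : #|V|%:R - 1 != 0 :> R by rewrite -nB pnatr_eq0 -lt0n -subn1 subn_gt0.
have /(congr1 (fun m => m%:R : R)) := bin_ffact #|V| 2.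
rewrite ffactnSr ffactn1 subn1 !natrM nB /density => binE.
have -> : 'C(#|V|, 2)%:R = #|V|%:R * (#|V|%:R - 1) / 2 :> R by rewrite -binE; field.
by field; apply/andP.
Qed.

Lemma density3_ge (R : realType) (V : finType) (F : {set {set V}}) :
  (2 < #|V|)%N -> 6 * #|F|%:R / #|V|%:R ^+ 3 <= density R 3 F.
Proof.
move=> V2; rewrite /density mulrAC mulrC ler_wpM2l//.
have n0 : 0 < #|V|%:R :> R by rewrite ltr0n (ltn_trans _ V2).
rewrite ler_pdivrMr ?exprn_gt0// mulrC ler_pdivlMr ?ltr0n ?bin_gt0//.
rewrite -natrX -natrM ler_nat mulnC (_ : 6%N = 3`!)// bin_ffact.
rewrite !ffactnSr ffactn0 mul1n subn0 !expnSr expn0 mul1n.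
by rewrite !leq_mul// leq_subr.
Qed.

Lemma min_coboundary_density_ge (R : realType) (n : nat) (alpha : R) :
  0 <= alpha <= 2 / 9 -> (2 < n)%N ->
  (((1 - n%:R^-1) * (3 / 4 * alpha * (3 - Num.sqrt (8 * alpha + 1))))%:E
    <= min_coboundary_density 'I_n 2 alpha)%E.
Proof.
move=> /andP[a0 a1] n2.
apply: le_bigmin => [|E /andP[Emin hE]]; first exact: leey.
rewrite lee_fin.
apply: le_trans (density3_ge R _ _ _); last by rewrite card_ord.
have [i0 i1] : 0 <= 1 - n%:R^-1 :> R /\ 1 - n%:R^-1 <= 1 :> R.
  by rewrite subr_ge0 gerBl invf_le1 ?invr_ge0 ?ltr0n ?ler0n ?ler1n (ltn_trans _ n2).
set i := 1 - _ in i0 i1 *.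
have b1 : i * alpha <= alpha by rewrite ler_piMl.
have V1 : (1 < #|'I_n|)%N by rewrite card_ord ltnW.
(* The factor [i] turns density into 2|E|/n^2. It stays outside in the final bound, and dropping it
   under the root only weakens the bound. *)
have := coboundary_ge_sqrt R 'I_n E (i * alpha) V1 Emin; rewrite mulr_ge0//=.
rewrite (le_trans b1)// -density2E// card_ord -/i ler_wpM2l// => /(_ isT isT).
apply: le_trans; rewrite mulrA !(mulrCA i) -!mulrA.
rewrite !ler_wpM2l// lerB// ler_wsqrtr//; lra.
Qed.

Theorem theorem4 (R : realType) (alpha : R)
    (halpha : 0 <= alpha <= 2 / 9) :
  ((3 / 4 * alpha * (3 - Num.sqrt (8 * alpha + 1)))%:E <= phi 2 alpha)%E.
Proof.
set c := 3 / 4 * _ * _.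
have cvgr : ((fun n : nat => (1 - n%:R^-1) * c) @ \oo --> c)%classic.
  rewrite -[X in (_ --> X)%classic]mul1r; apply: cvgM; last exact: cvg_cst.
  rewrite -[X in (_ --> X)%classic]subr0; apply: cvgB; first exact: cvg_cst.
  (* The harmonic sequence is 1/(n + 1), hence the shift. *)
  by rewrite -cvg_shiftS; exact: cvg_harmonic.
have cvgc : ((fun n : nat => ((1 - n%:R^-1) * c)%:E) @ \oo --> c%:E)%classic.
  by apply/fine_cvgP; split; [exact: nearW|exact: cvgr].
have c0 : 0 <= c.
  suff : Num.sqrt (8 * alpha + 1) <= 3 by move=> ?; rewrite mulr_ge0//; lra.
  by rewrite -(@ler_pXn2r _ 2)// ?nnegrE ?sqrtr_ge0// sqr_sqrtr; lra.
rewrite -(cvg_lim _ cvgc)// /phi limn_einf_lim.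
apply: lee_lim; [by apply/cvg_ex; exists c%:E|exact: is_cvg_einfs|].
(* The infimum over the tail from [n] is at least (1 - 1/n) c, because 1 - 1/k increases with [k]
   and c >= 0. *)
near=> n; apply: le_ereal_inf_tmp => _ /= [k nk <-].
have n2 : (2 < n)%N by near: n; exists 3.
apply: le_trans (min_coboundary_density_ge _ _ _ halpha (leq_trans n2 nk)).
have n0 : (0 < n)%N by exact: ltn_trans n2.
by rewrite lee_fin ler_wpM2r// lerB// lef_pV2 ?posrE ?ltr0n ?ler_nat ?(leq_trans n0 nk).
Unshelve. all: by end_near. Qed.
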